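(* Suppose that the following statement (Eggert's Conjecture) is true: for every prime $p$, every perfect field $F$ of characteristic $p$, and every finite-dimensional nilpotent commutative $F$-algebra $R$, $$\dim_F R\ \geq\ p\,\dim_F R^{(p)}.$$ Then the following statement (the semigroup version of Eggert's Conjecture) is also true: for every finite nilpotent commutative semigroup $S$ with zero element $0$, and every positive integer $n$, $$\mathrm{card}(S-\{0\})\ \geq\ n\,\mathrm{card}(S^{(n)}-\{0\}).$$
   Context: Algebras are associative but not assumed unital. An $F$-algebra $R$ is nilpotent if there is a positive integer $m$ with $R^m=\{0\}$, where $R^m$ is the $F$-span of all $m$-fold products of elements of $R$. $R^{(p)}=\{r^p\mid r\in R\}$ is the set of $p$-th powers of elements of $R$; for $R$ commutative over a perfect field $F$ of characteristic $p$ it is an $F$-subspace of $R$. Semigroups are written multiplicatively. A zero element of a semigroup $S$ is an element $0\in S$ with $s0=0s=0$ for all $s\in S$. A semigroup $S$ with zero is nilpotent if there is a positive integer $m$ such that every $m$-fold product of elements of $S$ equals $0$. $S^{(n)}=\{s^n\mid s\in S\}$ is the set of all $n$-th powers of elements of $S$. *)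

(* Defs.v *)
From mathcomp Require Import all_boot all_order all_algebra.

Set Implicit Arguments.
Unset Strict Implicit.
Unset Printing Implicit Defensive.

Import GRing.Theory.
Local Open Scope ring_scope.

(* The ring structures of the library are unital, and its semigroupType does  *)
(* not join with finType, so products are plain binary operations.            *)

(* An associative algebra structure, possibly without unit, on the space R.   *)
Record nonunital_algebra (F : fieldType) (R : lmodType F)
    (mul : R -> R -> R) : Prop := NonunitalAlgebra {
  algM_assoc : associative mul;
  algM_addl : left_distributive mul +%R;
  algM_addr : right_distributive mul +%R;
  algM_scalel : forall (a : F) (x y : R), mul (a *: x) y = a *: mul x y;
  algM_scaler : forall (a : F) (x y : R), mul x (a *: y) = a *: mul x y
}.

(* x ^ n for n > 0; without a unit the value at n = 0 is junk. *)
Definition spow (S : Type) (mul : S -> S -> S) (x : S) (n : nat) : S :=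
  iterop n mul x x.

(* x is an m-fold product y_1 * ... * y_m; never the case when m = 0. *)
Definition fold_product (S : Type) (mul : S -> S -> S) (m : nat) (x : S) :
    Prop :=
  exists (y : S) (s : seq S), size (y :: s) = m /\ x = foldl mul y s.

Definition zero_element (S : Type) (mul : S -> S -> S) (z : S) : Prop :=
  forall s : S, mul s z = z /\ mul z s = z.

Definition nilpotent_semigroup (S : Type) (mul : S -> S -> S) (z : S) : Prop :=
  exists2 m : nat, (0 < m)%N & forall x : S, fold_product mul m x -> x = z.

(* Membership in the F-span of a possibly infinite set P. *)
Definition in_span (F : fieldType) (V : vectType F) (P : V -> Prop) (x : V) :
    Prop :=
  exists2 X : seq V, (forall y : V, y \in X -> P y) & x \in <<X>>%VS.

Definition nilpotent_algebra (F : fieldType) (R : vectType F)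
    (mul : R -> R -> R) : Prop :=
  exists2 m : nat, (0 < m)%N &
    forall x : R, in_span (fold_product mul m) x <-> x = 0.

Definition perfect_of_char (p : nat) (F : fieldType) : Prop :=
  p \in [pchar F] /\ forall a : F, exists b : F, b ^+ p = a.

(* U is the set of all p-th powers. For a commutative algebra over a perfect  *)
(* field of characteristic p exactly one subspace U has this property.        *)
Definition is_power_subspace (F : fieldType) (R : vectType F)
    (mul : R -> R -> R) (p : nat) (U : {vspace R}) : Prop :=
  forall x : R, x \in U <-> exists r : R, x = spow mul r p.

(* Main.v *)
Require Import Defs.
From HB Require Import structures.
From mathcomp Require Import all_boot all_order all_algebra.

Set Implicit Arguments.
Unset Strict Implicit.
Unset Printing Implicit Defensive.

Import GRing.Theory.

(** The bridge between the two conjectures is the contracted semigroup algebra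
    of S: the algebra with basis S - {0} in which the zero of S is identified
    with the zero vector.  It inherits associativity, commutativity and
    nilpotence from S, and its dimension is card (S - {0}).

    Over the prime field 'F_p the p-th power map of this algebra is linear: it
    is additive in characteristic p, and it fixes scalars by Fermat's little
    theorem.  So the p-th powers form the image of a linear map, and this image
    contains the basis vectors indexed by the nonzero p-th powers of S.
    Eggert's conjecture for the algebra therefore gives the inequality for S
    when n = p is prime ([prime_power_bound]).

    The powers S^(p) again form a nilpotent commutative semigroup with zero, and
    the m-th powers of its elements are the (p m)-th powers of the elements of
    S, so the inequalities for the prime factors of an arbitrary n multiply
    ([power_bound]).  For this induction everything is stated for a
    multiplicatively closed subset A of a fixed semigroup.  *)

(** * Powers in a semigroup *)

Section SemigroupPowers.

Variables (S : Type) (mul : S -> S -> S).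
Hypothesis mulA : associative mul.

Lemma spowS x n : spow mul x n.+2 = mul x (spow mul x n.+1).
Proof. by rewrite /spow !iteropS. Qed.

Lemma spowD x m n :
  0 < m -> 0 < n -> spow mul x (m + n) = mul (spow mul x m) (spow mul x n).
Proof.
case: m => // m _; elim: m => [|m IHm] n_gt0; first by case: n n_gt0.
by rewrite addSn addSn spowS -addSn IHm // mulA -spowS.
Qed.

Lemma spowM x m n :
  0 < m -> 0 < n -> spow mul x (m * n) = spow mul (spow mul x m) n.
Proof.
move=> m_gt0; case: n => // n _; elim: n => [|n IHn]; first by rewrite muln1.
by rewrite mulnS spowD ?muln_gt0 ?m_gt0 // IHn spowS.
Qed.

Hypothesis mulC : commutative mul.

Lemma spowMl x y n :
  0 < n -> spow mul (mul x y) n = mul (spow mul x n) (spow mul y n).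
Proof.
case: n => // n _; elim: n => [//|n IHn]; rewrite !spowS IHn.
by rewrite !mulA; congr (mul _ _); rewrite -!mulA (mulC y).
Qed.

End SemigroupPowers.

Lemma spow_closed (S : finType) (mul : S -> S -> S) (A : {set S}) :
  {in A &, forall s t, mul s t \in A} ->
  forall s n, 0 < n -> s \in A -> spow mul s n \in A.
Proof.
move=> A_mul s n n_gt0 sA; case: n n_gt0 => // n _.
by elim: n => [//|n IHn]; rewrite spowS A_mul.
Qed.

(** * The Frobenius map of a commutative algebra without unit *)

Section Unitalization.

Local Open Scope ring_scope.

Variables (F : fieldType) (R : lmodType F) (mul : R -> R -> R).
Hypotheses (algR : nonunital_algebra mul) (mulC : commutative mul).

(** The type mentions the proofs [algR] and [mulC], so that the ring structure
    below, which depends on them, can be found from the type alone; it also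
    keeps the componentwise product of a pair of rings out of the way. *)
Definition unitalization : Type :=
  let _ := algR in let _ := mulC in (R * F)%type.

HB.instance Definition _ := GRing.Zmodule.copy unitalization (R * F)%type.

Definition unital_one : unitalization := (0, 1).

Definition unital_mul (x y : unitalization) : unitalization :=
  (mul x.1 y.1 + x.2 *: y.1 + y.2 *: x.1, x.2 * y.2).

Fact alg_mul0r x : mul 0 x = 0.
Proof. by have := algM_scalel algR 0 0 x; rewrite !scale0r. Qed.

Fact unital_mulC : commutative unital_mul.
Proof.
by move=> x y; rewrite /unital_mul mulC (mulrC x.2) addrAC.
Qed.

Fact unital_mul1 : left_id unital_one unital_mul.
Proof.
case=> x a; rewrite /unital_mul /= alg_mul0r add0r scale1r scaler0 addr0.
by rewrite mul1r.
Qed.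

Fact unital_mulD : left_distributive unital_mul +%R.
Proof.
move=> [x a] [y b] [w c]; congr (_, _); rewrite /= ?mulrDl //.
by rewrite (algM_addl algR) scalerDl scalerDr !addrA [LHS](ACl (1*3*5*2*4*6)).
Qed.

Fact unital_mulA : associative unital_mul.
Proof.
move=> [x a] [y b] [w c]; congr (_, _); rewrite /= ?mulrA //.
rewrite !(algM_addl algR) !(algM_addr algR) !(algM_scalel algR).
rewrite !(algM_scaler algR) (algM_assoc algR) !scalerDr !scalerA.
by rewrite !addrA (mulrC c a) (mulrC c b) [LHS](ACl (1*4*2*5*3*6*7)).
Qed.

Fact unital_one_neq0 : unital_one != 0.
Proof. by rewrite -pair_eqE /= oner_eq0 andbF. Qed.

HB.instance Definition _ := GRing.Zmodule_isComNzRing.Build unitalization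
  unital_mulA unital_mulC unital_mul1 unital_mulD unital_one_neq0.

Lemma unitalizationX x n :
  ((x, 0) : unitalization) ^+ n.+1 = (spow mul x n.+1, 0).
Proof.
elim: n => [//|n IHn]; rewrite exprS {}IHn spowS.
by congr (_, _); rewrite /= ?scale0r ?addr0 ?mul0r.
Qed.

Lemma pchar_unitalization p :
  p \in [pchar F] -> p \in [pchar unitalization].
Proof.
case/andP=> p_pr /eqP pF; apply/andP; split=> //; apply/eqP.
have natE n : n%:R = (0, n%:R) :> unitalization.
  by elim: n => [//|n IHn]; rewrite mulrSr {}IHn [in RHS]mulrSr; congr (_, _);
     rewrite /= addr0.
by rewrite natE pF.
Qed.

(** In the unitalization this is the additivity of the Frobenius endomorphism
    of a commutative ring of characteristic p; the algebra sits inside as the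
    pairs with scalar component 0. *)
Lemma spow_pcharD p x y :
  p \in [pchar F] -> spow mul (x + y) p = spow mul x p + spow mul y p.
Proof.
move=> pF; have pU := pchar_unitalization pF.
have := rmorphD (pFrobenius_aut pU)
  ((x, 0) : unitalization) ((y, 0) : unitalization).
have -> : (x, 0) + (y, 0) = (x + y, 0) :> unitalization.
  by congr (_, _); rewrite /= addr0.
rewrite /= !pFrobenius_autE -(prednK (prime_gt0 (pcharf_prime pF))).
by rewrite !unitalizationX => -[].
Qed.

Lemma spow_scale (a : F) x n :
  (0 < n)%N -> spow mul (a *: x) n = a ^+ n *: spow mul x n.
Proof.
case: n => // n _; elim: n => [//|n IHn].
by rewrite !spowS IHn (algM_scalel algR) (algM_scaler algR) scalerA -exprS.
Qed.

End Unitalization.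

(** * The contracted semigroup algebra *)

Section ContractedAlgebra.

Local Open Scope ring_scope.

Variables (S : finType) (mul : S -> S -> S) (z : S) (A : {set S}).
Variable F : fieldType.

Notation T := (sig (fun s : S => s \in A :\ z)).

Definition contracted_algebra := {ffun T -> F^o}.
HB.instance Definition _ := Vector.copy contracted_algebra {ffun T -> F^o}.
Notation R := contracted_algebra.

(** An element outside the index set, such as [z], goes to the zero vector; so
    products can be formed in the semigroup without asking whether they
    vanish. *)
Definition contract (s : S) : R := [ffun u => (val u == s)%:R].

(** The bilinear extension of the product of the semigroup. *)
Definition contracted_mul (f g : R) : R :=
  \sum_u \sum_v (f u * g v : F) *: contract (mul (val u) (val v)).

Lemma dim_contracted_algebra : \dim {: R} = #|A :\ z|.
Proof.
by rewrite dimvf; change (#|{: T}| * 1 = #|A :\ z|)%N; rewrite muln1 card_sig.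
Qed.

Lemma contract0 : contract z = 0.
Proof.
by apply/ffunP=> u; rewrite !ffunE; have /setD1P[/negPf-> _] := valP u.
Qed.

Lemma contract_coord (f : R) : f = \sum_u f u *: contract (val u).
Proof.
apply/ffunP=> v; rewrite sum_ffunE (bigD1 v) //= big1 => [|u uv].
  by rewrite !ffunE eqxx addr0 [RHS]mulr1.
by rewrite !ffunE (inj_eq val_inj) eq_sym (negPf uv) [LHS]mulr0.
Qed.

Lemma contracted_mulDl : left_distributive contracted_mul +%R.
Proof.
move=> f g h; rewrite -big_split; apply: eq_bigr => u _ /=.
rewrite -big_split; apply: eq_bigr => v _ /=.
by rewrite ffunE mulrDl scalerDl.
Qed.

Lemma contracted_mulZl (a : F) f g :
  contracted_mul (a *: f) g = a *: contracted_mul f g.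
Proof.
rewrite scaler_sumr; apply: eq_bigr => u _.
rewrite scaler_sumr; apply: eq_bigr => v _.
by rewrite ffunE scalerA [in RHS]mulrA.
Qed.

Lemma contracted_mul0l g : contracted_mul 0 g = 0.
Proof.
by rewrite -[X in contracted_mul X](scale0r 0) contracted_mulZl scale0r.
Qed.

Lemma contracted_mul_suml (a : T -> F) (f : _ -> R) g :
  contracted_mul (\sum_u a u *: f u) g = \sum_u a u *: contracted_mul (f u) g.
Proof.
rewrite (big_morph (contracted_mul^~ g) (fun x y => contracted_mulDl x y g)
  (contracted_mul0l g)).
by apply: eq_bigr => u _; rewrite contracted_mulZl.
Qed.

Hypotheses (mulA : associative mul) (mulC : commutative mul).
Hypothesis z_zero : zero_element mul z.
Hypothesis A_mul : {in A &, forall s t, mul s t \in A}.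

Lemma contracted_mulC : commutative contracted_mul.
Proof.
move=> f g; rewrite /contracted_mul exchange_big /=.
by apply: eq_bigr => u _; apply: eq_bigr => v _; rewrite mulrC mulC.
Qed.

(** Commutativity serves only to reduce the case [t = z] to [s = z]; elsewhere
    both factors are basis vectors and a single term of the double sum
    survives. *)
Lemma contractM : {in A &, forall s t,
  contracted_mul (contract s) (contract t) = contract (mul s t)}.
Proof.
have contract_mul0 x : contracted_mul (contract z) x = 0.
  by rewrite contract0 contracted_mul0l.
move=> s t sA tA.
have [->|sz] := eqVneq s z.
  by rewrite (z_zero t).2 contract_mul0 contract0.
have [->|tz] := eqVneq t z.
  by rewrite (z_zero s).1 contracted_mulC contract_mul0 contract0.
have sT : s \in A :\ z by apply/setD1P.
have tT : t \in A :\ z by apply/setD1P.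
rewrite /contracted_mul (bigD1 (Sub s sT)) //=.
rewrite [X in _ + X]big1 => [|u us]; last first.
  rewrite big1 // => v _; rewrite ffunE -(inj_eq val_inj) /= in us *.
  by rewrite (negPf us) mul0r scale0r.
rewrite addr0 (bigD1 (Sub t tT)) //= big1 => [|v vt]; last first.
  rewrite !ffunE -(inj_eq val_inj) /= in vt *.
  by rewrite (negPf vt) mulr0 scale0r.
by rewrite !ffunE /= !eqxx mulr1 scale1r addr0.
Qed.

Lemma contracted_basisP (u : T) : val u \in A.
Proof. by case/setD1P: (valP u). Qed.

Lemma contracted_mul_sumr (a : T -> F) (f : _ -> R) g :
  contracted_mul g (\sum_u a u *: f u) = \sum_u a u *: contracted_mul g (f u).
Proof.
rewrite contracted_mulC contracted_mul_suml.
by apply: eq_bigr => u _; rewrite contracted_mulC.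
Qed.

Lemma contracted_mulA : associative contracted_mul.
Proof.
move=> f g h; rewrite (contract_coord f) !contracted_mul_suml.
apply: eq_bigr => u _; congr (_ *: _).
rewrite (contract_coord g) contracted_mul_suml !contracted_mul_sumr.
rewrite contracted_mul_suml; apply: eq_bigr => v _; congr (_ *: _).
rewrite (contract_coord h) !contracted_mul_sumr.
apply: eq_bigr => w _; congr (_ *: _).
by rewrite !contractM ?A_mul ?contracted_basisP // mulA.
Qed.

Lemma contracted_nonunital_algebra : nonunital_algebra contracted_mul.
Proof.
split=> [||f g h|a f g|a f g]; last 1 first.
- by rewrite contracted_mulC contracted_mulZl contracted_mulC.
- exact: contracted_mulA.
- exact: contracted_mulDl.
- by rewrite !(contracted_mulC f) contracted_mulDl.
- exact: contracted_mulZl.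
Qed.

Lemma foldl_contracted_mul_sum (a : T -> F) (f : _ -> R) gs :
  foldl contracted_mul (\sum_u a u *: f u) gs =
    \sum_u a u *: foldl contracted_mul (f u) gs.
Proof.
by elim: gs f => [//|g gs IHgs] f /=; rewrite contracted_mul_suml IHgs.
Qed.

(** By multilinearity a product of vectors is a combination of contracted
    products of the same number of semigroup elements. *)
Lemma foldl_contracted_mul_eq0 s gs :
    s \in A ->
    (forall ss : seq S, size ss = size gs -> foldl mul s ss = z) ->
  foldl contracted_mul (contract s) gs = 0.
Proof.
elim: gs s => [|g gs IHgs] s sA prod0 /=.
  by have /= -> := prod0 [::] erefl; apply: contract0.
rewrite (contract_coord g) contracted_mul_sumr foldl_contracted_mul_sum.
rewrite big1 // => u _; rewrite contractM ?contracted_basisP //.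
rewrite IHgs ?scaler0 //.
  by rewrite A_mul ?contracted_basisP.
by move=> ss sz_ss; apply: (prod0 (val u :: ss)); rewrite /= sz_ss.
Qed.

Lemma contracted_nilpotent :
  nilpotent_semigroup mul z -> nilpotent_algebra contracted_mul.
Proof.
case=> m m_gt0 prod0; exists m => // x; split=> [[X X_prod]|->]; last first.
  by exists [::]; rewrite ?mem0v.
suff X0: (<<X>> <= 0)%VS by move/(subvP X0); rewrite memv0 => /eqP.
apply/span_subvP => _ /X_prod[f [gs [sz_gs ->]]]; rewrite memv0.
rewrite (contract_coord f) foldl_contracted_mul_sum big1 // => u _.
rewrite foldl_contracted_mul_eq0 ?scaler0 ?contracted_basisP // => ss sz_ss.
by apply: prod0; exists (val u), ss; rewrite -sz_gs /= sz_ss.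
Qed.

Lemma contractX s n : (0 < n)%N -> s \in A ->
  spow contracted_mul (contract s) n = contract (spow mul s n).
Proof.
case: n => // n _ sA; elim: n => [//|n IHn].
by rewrite !spowS IHn contractM // spow_closed.
Qed.

(** The vectors [contract s] with s in B are distinct members of the basis, so
    B indexes a free family. *)
Lemma leq_card_contract (B : {set S}) (U : {vspace R}) :
  B \subset A :\ z -> {in B, forall s, contract s \in U} -> (#|B| <= \dim U)%N.
Proof.
move=> BA BU; pose X := [tuple contract (enum_val i) | i < #|B|].
have freeX : free X.
  apply/freeP=> k /ffunP sum0 i.
  have iA : enum_val i \in A :\ z by rewrite (subsetP BA) ?enum_valP.
  have := sum0 (Sub (enum_val i) iA).
  rewrite sum_ffunE (bigD1 i) //= big1 => [|j ji].
    rewrite (nth_map i) ?size_enum_ord // nth_ord_enum !ffunE eqxx addr0.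
    by rewrite [_ *: _]mulr1.
  rewrite (nth_map i) ?size_enum_ord // nth_ord_enum !ffunE /=.
  by rewrite (inj_eq enum_val_inj) eq_sym (negPf ji) [LHS]mulr0.
move: freeX; rewrite /free size_tuple => /eqP <-; apply/dimvS/span_subvP.
by move=> _ /mapP[i _ ->]; rewrite BU ?enum_valP.
Qed.

End ContractedAlgebra.

(** * From algebras to semigroups *)

Definition eggert_conjecture : Prop :=
  forall (p : nat) (F : fieldType) (R : vectType F) (mul : R -> R -> R),
    prime p -> perfect_of_char p F ->
    nonunital_algebra mul -> commutative mul -> nilpotent_algebra mul ->
    forall U : {vspace R}, is_power_subspace mul p U ->
    p * \dim U <= \dim {: R}.

Lemma Fp_exp_id p (a : 'F_p) : prime p -> (a ^+ p)%R = a.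
Proof.
by move=> p_pr; rewrite -(pFrobenius_autE (pchar_Fp p_pr)) -[in LHS](natr_Zp a)
   pFrobenius_aut_nat natr_Zp.
Qed.

(** Over 'F_p the Frobenius map is not only additive but linear, because it
    fixes scalars; its image is the subspace. *)
Lemma Fp_power_subspace p (R : vectType 'F_p) (mul : R -> R -> R) :
    prime p -> nonunital_algebra mul -> commutative mul ->
  exists U : {vspace R}, is_power_subspace mul p U.
Proof.
move=> p_pr algR mulC; pose frob (x : R) : R := spow mul x p.
have frob_lin : linear frob.
  move=> a x y; rewrite /frob (spow_pcharD algR mulC) ?pchar_Fp //.
  by rewrite (spow_scale algR a x (prime_gt0 p_pr)) (Fp_exp_id a p_pr).
pose frobL : {linear R -> R} :=
  HB.pack frob (GRing.isLinear.Build _ _ _ _ frob frob_lin).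
exists (limg (linfun frobL)) => x; split=> [/memv_imgP[r _ ->]|[r ->]].
  by exists r; rewrite lfunE.
by apply/memv_imgP; exists r; rewrite ?memvf // lfunE.
Qed.

Section PowerBounds.

Variables (S : finType) (mul : S -> S -> S) (z : S).
Hypotheses (mulA : associative mul) (mulC : commutative mul).
Hypotheses (z_zero : zero_element mul z) (nilS : nilpotent_semigroup mul z).
Hypothesis eggert : eggert_conjecture.

(** The contraction of a nonzero p-th power of the semigroup is a basis vector
    that is a p-th power in the contracted algebra, so the subspace of p-th
    powers has at least the dimension required. *)
Lemma prime_power_bound p (A : {set S}) :
    prime p -> {in A &, forall s t, mul s t \in A} ->
  p * #|[set spow mul s p | s in A] :\ z| <= #|A :\ z|.
Proof.
move=> p_pr A_mul; have p_gt0 := prime_gt0 p_pr.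
pose R : vectType 'F_p := contracted_algebra z A 'F_p.
pose mulR : R -> R -> R := @contracted_mul S mul z A 'F_p.
have mulRC : commutative mulR by apply: contracted_mulC.
have algR : nonunital_algebra mulR by apply: contracted_nonunital_algebra.
have [U U_powers] := Fp_power_subspace p_pr algR mulRC.
rewrite -(dim_contracted_algebra z A 'F_p).
apply: leq_trans (eggert p_pr _ algR mulRC _ U_powers).
- rewrite leq_pmul2l //; apply: leq_card_contract.
    apply/subsetP=> x /setD1P[xz /imsetP[s sA xE]]; rewrite !inE xz xE.
    exact: spow_closed.
  move=> _ /setD1P[_ /imsetP[s sA ->]]; apply/U_powers.
  by exists (contract z A 'F_p s); rewrite /mulR contractX.
- split; first exact: pchar_Fp.
  by move=> a; exists a; apply: Fp_exp_id.
- exact: contracted_nilpotent.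
Qed.

(** Splitting off one prime factor p of n = p * m leaves the m-th powers of the
    smaller closed set A^(p), and (A^(p))^(m) = A^(n). *)
Lemma power_bound n (A : {set S}) :
    0 < n -> {in A &, forall s t, mul s t \in A} ->
  n * #|[set spow mul s n | s in A] :\ z| <= #|A :\ z|.
Proof.
have [k] := ubnP n; elim: k => // k IHk in n A *; rewrite ltnS => le_nk n_gt0.
move=> A_mul; have [n1|n_neq1] := eqVneq n 1.
  by rewrite n1 mul1n imset_id.
have p_pr : prime (pdiv n) by rewrite pdiv_prime // ltn_neqAle eq_sym n_neq1.
have p_gt0 := prime_gt0 p_pr; have p_dvd := pdiv_dvd n.
set p := pdiv n in p_pr p_gt0 p_dvd; pose m := n %/ p.
have m_gt0 : 0 < m by rewrite divn_gt0 // dvdn_leq.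
have nE : n = p * m by rewrite mulnC divnK.
pose B := [set spow mul s p | s in A].
have B_mul : {in B &, forall s t, mul s t \in B}.
  move=> _ _ /imsetP[s sA ->] /imsetP[t tA ->].
  by rewrite -spowMl //; apply/imset_f/A_mul.
have -> : [set spow mul s n | s in A] = [set spow mul t m | t in B].
  by rewrite -imset_comp; apply: eq_imset => s /=; rewrite nE spowM.
apply: leq_trans (prime_power_bound p_pr A_mul).
rewrite [in X in X <= _]nE -mulnA leq_pmul2l //; apply: IHk => //.
by rewrite (leq_trans _ le_nk) // ltn_Pdiv // prime_gt1.
Qed.

End PowerBounds.

Theorem lemma9 :
  (forall (p : nat) (F : fieldType) (R : vectType F) (mul : R -> R -> R),
     prime p -> perfect_of_char p F ->
     nonunital_algebra mul -> commutative mul -> nilpotent_algebra mul ->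
     forall U : {vspace R}, is_power_subspace mul p U ->
     p * \dim U <= \dim {: R}) ->
  (forall (S : finType) (mul : S -> S -> S) (z : S),
     associative mul -> commutative mul ->
     zero_element mul z -> nilpotent_semigroup mul z ->
     forall n : nat, 0 < n ->
     n * #|[set spow mul s n | s : S] :\ z| <= #|[set: S] :\ z|).
Proof.
move=> eggert S mul z mulA mulC z_zero nilS n n_gt0.
have <- : [set spow mul s n | s in [set: S]] = [set spow mul s n | s : S].
  by apply/setP=> t; apply/imsetP/imsetP=> -[s _ ->]; exists s.
exact: power_bound.
Qed.
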